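(* Let $H$ be a finite group with generators $h_1,\ldots,h_e$ (pairwise distinct) and a confluent rewriting system $\mathcal{R}_H$ as in the context, let $p$ be a prime, and let $V$ be a $d$-dimensional $\mathbb{Z}_pH$-module. Let $\mathcal{R}(\mathbf{x})$, $X=\{\mathbf{y}\in\mathbb{Z}_p^{dr}:\mathcal{R}(\mathbf{y})\text{ is confluent}\}$ and the linear map $\xi\colon Z^2(H,V)\to\mathbb{Z}_p^{dr}$ be as in the context. Then the tuples that make $\mathcal{R}$ confluent form a $\mathbb{Z}_p$-vector space $X=\xi(Z^2(H,V))$, and $\ker\xi\leq B^2(H,V)$; hence $H^2(H,V)\cong\xi(Z^2(H,V))/\xi(B^2(H,V))$.
   Context: Rewriting system for $H$. Consider $H$ as a monoid generated by $\{h_1^{\pm1},\ldots,h_e^{\pm1}\}$, a quotient of the free monoid $A$ on the $2e$ symbols $a_1^{\pm1},\ldots,a_e^{\pm1}$ via $a_i^{\pm1}\mapsto h_i^{\pm1}$ ($a_i^{-1}$ is a formal symbol). Let $\mathcal{R}_H$ be a confluent rewriting system for $H$ on these generators with respect to a reduction order $\prec_a$: a finite set of rules $l\to r$ with $r\prec_a l$. It is assumed that, for $h_i$ of order different from $2$, $\mathcal{R}_H$ contains $a_ia_i^{-1}\to\emptyset$ and $a_i^{-1}a_i\to\emptyset$ ($\emptyset$ is the empty word), and, for $h_i$ of order $2$, $\mathcal{R}_H$ contains $a_i^{-1}\to a_i$ and $a_i^2\to\emptyset$ instead. Let $\overline{\mathcal{R}}_H\subset\mathcal{R}_H$ consist of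 the rules $a_ia_i^{-1}\to\emptyset$, $a_i^{-1}a_i\to\emptyset$ (order $\neq2$) and $a_i^{-1}\to a_i$ (order $2$); the rules $a_i^2\to\emptyset$ are not in $\overline{\mathcal{R}}_H$. Put $\widetilde{\mathcal{R}}_H=\mathcal{R}_H\setminus\overline{\mathcal{R}}_H=\{l_i\to r_i: i=1,\ldots,r\}$. Module. Let $v_1,\ldots,v_d$ be a basis of $V$, written multiplicatively, $\mathbf{v}^{\mathbf{f}}=v_1^{f_1}\cdots v_d^{f_d}$ for $\mathbf{f}\in\mathbb{Z}_p^d$. Take symbols $b_1,\ldots,b_d$, write $\mathbf{b}^{\mathbf{f}}=b_1^{f_1}\cdots b_d^{f_d}$ with exponents in $\{0,\ldots,p-1\}$, and let $\mathcal{R}_V=\{b_i^p\to\emptyset,\ b_jb_i\to b_ib_j: 1\leq i\leq d,\ j>i\}$. Let $\mathcal{R}_M$ be the set of rules $b_ja_i^{\sigma}\to a_i^{\sigma}\mathbf{b}^{\mathbf{f}}$ for $\sigma\in\{\pm1\}$, $1\leq i\leq e$, $1\leq j\leq d$, where $\mathbf{f}\in\mathbb{Z}_p^d$ is given by $v_j^{h_i^\sigma}=\mathbf{v}^{\mathbf{f}}$ in $V$. Extended system. For $\mathbf{y}=(y_{1,1},\ldots,y_{1,d},\ldots,y_{r,1},\ldots,y_{r,d})\in\mathbb{Z}_p^{dr}$ put $\mathcal{R}_H(\mathbf{y})=\{l_i\to r_i\,\mathbf{b}^{(y_{i,1},\ldots,y_{i,d})}: i=1,\ldots,r\}$ and $\mathcal{R}(\mathbf{y})=\mathcal{R}_H(\mathbf{y})\cup\mathcal{R}_V\cup\mathcal{R}_M\cup\overline{\mathcal{R}}_H$,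 a rewriting system on the alphabet $\{a_1^{\pm1},\ldots,a_e^{\pm1},b_1,\ldots,b_d\}$ with respect to the wreath product ordering $\prec_b\wr\prec_a$, where $\prec_b$ is the iterated wreath product of the length orderings on words in a single symbol $b_i$. The map $\xi$. For $\gamma\in Z^2(H,V)$ let $E_\gamma$ be the group with underlying set $H\times V$ and multiplication $(g,v)(h,w)=(gh,v^hw\gamma(g,h))$, and identify $V$ with the kernel of $E_\gamma\to H$, $(h,v)\mapsto h$. Put $u_i=(h_i,1)\in E_\gamma$. Evaluate words in $E_\gamma$ by $a_i\mapsto u_i$, $b_j\mapsto v_j$, and $a_i^{-1}\mapsto u_i^{-1}$ if $h_i$ does not have order $2$, $a_i^{-1}\mapsto u_i$ if $h_i$ has order $2$. Then $\xi(\gamma)$ is the unique $\mathbf{y}\in\mathbb{Z}_p^{dr}$ such that all rules of $\mathcal{R}_H(\mathbf{y})$ hold as equations in $E_\gamma$. $Z^2$, $B^2$ and $H^2$ denote $2$-cocycles, $2$-coboundaries and second cohomology. *)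

(* Defs.v *)
From HB Require Import structures.
From Stdlib Require Import Relations.
From mathcomp Require Import all_boot all_order all_algebra.
From mathcomp Require Import all_fingroup all_solvable all_field all_character.
From mathcomp Require Import ring.

Set Implicit Arguments.
Unset Strict Implicit.
Unset Printing Implicit Defensive.

Import GRing.Theory.
Local Open Scope ring_scope.

Section Rewriting.
Variable L : eqType.
Implicit Types (R : seq (seq L * seq L)) (lt : seq L -> seq L -> Prop).

Definition rule : Type := (seq L * seq L)%type.

Definition rstep R (u v : seq L) : Prop :=
  exists x y l r,
    [/\ (l, r) \in R, u = x ++ l ++ y & v = x ++ r ++ y].

Definition rsteps R : seq L -> seq L -> Prop := clos_refl_trans _ (rstep R).

Definition requiv R : seq L -> seq L -> Prop :=
  clos_refl_sym_trans _ (rstep R).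

Definition confluent R : Prop :=
  forall u v w, rsteps R u v -> rsteps R u w ->
  exists2 z, rsteps R v z & rsteps R w z.

(* Totality is not required, so well-orderings of the words are a special
   case; irreflexivity follows from well-foundedness. *)
Definition reduction_order lt : Prop :=
  [/\ forall u v w, lt u v -> lt v w -> lt u w,
      well_founded lt
    & forall x y u v, lt u v -> lt (x ++ u ++ y) (x ++ v ++ y)].

Definition rewriting_system lt R : Prop :=
  forall l r, (l, r) \in R -> lt r l.

Definition confluent_rewriting_system lt R : Prop :=
  rewriting_system lt R /\ confluent R.

(* The kernel congruence of the evaluation map ev is the one generated by R, so
   R defines the monoid ev maps onto. *)
Definition defines (G : Type) (ev : seq L -> G) R : Prop :=
  forall u v, ev u = ev v <-> requiv R u v.

End Rewriting.

Section Wreath.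
Variables (T K L : Type) (split : T -> K + L).

Definition uppers : seq T -> seq K :=
  pmap (fun x => if split x is inl k then Some k else None).

(* For w = B_0 k_1 B_1 ... k_n B_n with the k_i upper letters and the B_i
   words in the lower letters, lowers w = [:: B_0; ...; B_n]. *)
Definition lowers : seq T -> seq (seq L) :=
  foldr (fun x Bs => match split x with
                     | inl _ => [::] :: Bs
                     | inr l => (l :: head [::] Bs) :: behead Bs
                     end) [:: [::]].

Fixpoint lex_lt (ltL : seq L -> seq L -> Prop) (s t : seq (seq L)) : Prop :=
  match s, t with
  | B :: s', C :: t' => ltL B C \/ (B = C /\ lex_lt ltL s' t')
  | _, _ => False
  end.

Definition wreath (ltL : seq L -> seq L -> Prop) (ltK : seq K -> seq K -> Prop)
    (u v : seq T) : Prop :=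
  ltK (uppers u) (uppers v) \/
  (uppers u = uppers v /\ lex_lt ltL (lowers u) (lowers v)).

End Wreath.

Definition length_lt T (u v : seq T) : Prop := (size u < size v)%N.

(* The length ordering in the single symbol b_1 dominates, then b_2, and so on:
   this is the direction that makes b_j b_i -> b_i b_j decreasing for j > i. *)
Definition blt (d : nat) : seq 'I_d -> seq 'I_d -> Prop :=
  foldr (fun j lt =>
           wreath (fun x => if x == j then inl tt else inr x) lt
                  (@length_lt unit))
        (fun _ _ => False) (enum 'I_d).

(* (i, true) stands for a_i and (i, false) for the formal symbol a_i^-1. *)
Notation aletter e := ('I_e * bool)%type.

(* inl x is a letter a_i^{+-1}, and inr j is b_j. *)
Notation letter e d := (aletter e + 'I_d)%type.

Definition abword e d (w : seq (aletter e)) : seq (letter e d) := map inl w.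

Definition bword e p d (f : 'rV['F_p]_d) : seq (letter e d) :=
  flatten [seq nseq (f 0 j) (inr j) | j <- enum 'I_d].

Definition ablt e d (lta : seq (aletter e) -> seq (aletter e) -> Prop) :
    seq (letter e d) -> seq (letter e d) -> Prop :=
  wreath id (@blt d) lta.

Section RulesH.
Variables (gT : finGroupType) (e : nat) (h : 'I_e -> gT).
Variable RH : seq (rule (aletter e)).

Definition hletter (x : aletter e) : gT :=
  if x.2 then h x.1 else ((h x.1)^-1)%g.

Definition evalH (w : seq (aletter e)) : gT := (\prod_(x <- w) hletter x)%g.

Definition has_inverse_rules : Prop :=
  forall i,
    if #[h i]%g == 2%N
    then ([:: (i, false)], [:: (i, true)]) \in RH /\
         ([:: (i, true); (i, true)], [::]) \in RH
    else ([:: (i, true); (i, false)], [::]) \in RH /\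
         ([:: (i, false); (i, true)], [::]) \in RH.

Definition RHbar : seq (rule (aletter e)) :=
  flatten [seq if #[h i]%g == 2%N
               then [:: ([:: (i, false)], [:: (i, true)])]
               else [:: ([:: (i, true); (i, false)], [::]);
                        ([:: (i, false); (i, true)], [::])]
          | i <- enum 'I_e].

Definition RHtilde : seq (rule (aletter e)) := [seq x <- RH | x \notin RHbar].

End RulesH.

Section Module.
Variables (gT : finGroupType) (p d : nat).

(* Right modules: v^g = v *m rG g; the basis v_1, ..., v_d of V is the standard
   basis of row vectors. *)
Variable rG : mx_representation 'F_p [set: gT] d.

Definition vbase (j : 'I_d) : 'rV['F_p]_d := delta_mx 0 j.

Section RulesHV.
Variables (e : nat) (h : 'I_e -> gT) (RH : seq (rule (aletter e))).

Definition RV : seq (rule (letter e d)) :=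
  [seq (nseq p (inr j), [::]) | j <- enum 'I_d] ++
  [seq ([:: inr ji.1; inr ji.2], [:: inr ji.2; inr ji.1])
  | ji : 'I_d * 'I_d <- enum {: 'I_d * 'I_d} & (val ji.2 < val ji.1)%N].

Definition RM : seq (rule (letter e d)) :=
  [seq ([:: inr jx.1; inl jx.2],
        inl jx.2 :: bword e (vbase jx.1 *m rG (hletter h jx.2)))
  | jx : 'I_d * aletter e <- enum {: 'I_d * aletter e}].

(* Row i of y is (y_{i,1}, ..., y_{i,d}). *)
Definition tuples : Type := 'M['F_p]_(size (RHtilde h RH), d).

Definition RHy (y : tuples) : seq (rule (letter e d)) :=
  [seq (let lr := tnth (in_tuple (RHtilde h RH)) i in
        (abword d lr.1, abword d lr.2 ++ bword e (row i y)))
  | i <- enum 'I_(size (RHtilde h RH))].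

Definition Ry (y : tuples) : seq (rule (letter e d)) :=
  RHy y ++ RV ++ RM ++ [seq (abword d lr.1, abword d lr.2) | lr <- RHbar h].

End RulesHV.

(* Cochains are written additively and need not be normalized. *)
Definition cochain1 : Type := {ffun gT -> 'rV['F_p]_d}.
Definition cochain2 : Type := {ffun gT * gT -> 'rV['F_p]_d}.
Definition cochain3 : Type := {ffun gT * gT * gT -> 'rV['F_p]_d}.
HB.instance Definition _ := Vector.copy cochain1 {ffun gT -> 'rV['F_p]_d}.
HB.instance Definition _ := Vector.copy cochain2 {ffun gT * gT -> 'rV['F_p]_d}.
HB.instance Definition _ :=
  Vector.copy cochain3 {ffun gT * gT * gT -> 'rV['F_p]_d}.

Definition d1 (k : cochain1) : cochain2 :=
  [ffun gh => k gh.1 *m rG gh.2 + k gh.2 - k (gh.1 * gh.2)%g].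

Definition d2 (c : cochain2) : cochain3 :=
  [ffun ghk => let: (g, h, k) := ghk in
     c (g, h) *m rG k + c ((g * h)%g, k) - c (h, k) - c (g, (h * k)%g)].

Lemma d1_is_linear : linear d1.
Proof.
move=> a k k'; apply/ffunP=> -[g h]; rewrite !ffunE /= mulmxDl -scalemxAl.
move: (k g *m _) (k' g *m _) => u u'.
by apply/rowP=> j; rewrite !mxE; ring.
Qed.
HB.instance Definition _ := GRing.isSemilinear.Build 'F_p cochain1 cochain2 _ d1
  (GRing.semilinear_linear d1_is_linear).

Lemma d2_is_linear : linear d2.
Proof.
move=> a c c'; apply/ffunP=> -[[g h] k]; rewrite !ffunE /= mulmxDl -scalemxAl.
move: (c (g, h) *m _) (c' (g, h) *m _) => u u'.
by apply/rowP=> j; rewrite !mxE; ring.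
Qed.
HB.instance Definition _ := GRing.isSemilinear.Build 'F_p cochain2 cochain3 _ d2
  (GRing.semilinear_linear d2_is_linear).

Definition Z2 : {vspace cochain2} := lker (linfun d2).
Definition B2 : {vspace cochain2} := limg (linfun d1).

Lemma repr_mx_mul g h : rG (g * h)%g = rG g *m rG h.
Proof. by rewrite repr_mxM ?inE. Qed.

Lemma mem_Z2 (c : cochain2) :
  reflect (forall g h k, c (g, h) *m rG k + c ((g * h)%g, k) =
                         c (h, k) + c (g, (h * k)%g))
          (c \in Z2).
Proof.
rewrite memv_ker lfunE /=; apply: (iffP eqP) => [/ffunP d2c g h k | cP].
  have /eqP := d2c (g, h, k); rewrite !ffunE -addrA -opprD subr_eq0.
  by move/eqP.
by apply/ffunP=> -[[g h] k]; rewrite !ffunE cP -addrA -opprD subrr.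
Qed.

Lemma B2_sub_Z2 : (B2 <= Z2)%VS.
Proof.
apply/subvP=> _ /memv_imgP[k _ ->]; apply/mem_Z2=> f g h.
rewrite lfunE /= !ffunE /= mulgA repr_mx_mul !mulmxDl mulNmx mulmxA.
move: (k f *m _ *m _) (k g *m _) (k (f * g)%g *m _) => u v w.
by apply/rowP=> j; rewrite !mxE; ring.
Qed.

(* The group E_gamma on H x V; its multiplication depends on the cocycle. *)
Definition ext_of (c : subvs_of Z2) : Type := (gT * 'rV['F_p]_d)%type.
HB.instance Definition _ c := Finite.copy (ext_of c) (gT * 'rV['F_p]_d)%type.

Section Extension.
Variable c : subvs_of Z2.
Local Notation ext := (ext_of c).

Definition gam (g h : gT) : 'rV['F_p]_d := vsval c (g, h).

Lemma gamP g h k :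
  gam g h *m rG k + gam (g * h)%g k = gam h k + gam g (h * k)%g.
Proof. exact: (mem_Z2 _ (subvsP c)). Qed.

Lemma gam1l h : gam 1 1 *m rG h = gam 1 h.
Proof. by have := gamP 1 1 h; rewrite !mul1g => /addIr. Qed.

Lemma gam1r g : gam g 1 = gam 1 1.
Proof.
by have := gamP g 1 1; rewrite !mulg1 repr_mx1 mulmx1 => /addIr.
Qed.

Definition ext_mul (x y : ext) : ext :=
  ((x.1 * y.1)%g, x.2 *m rG y.1 + y.2 + gam x.1 y.1).
Definition ext_one : ext := (1%g, - gam 1 1).
Definition ext_inv (x : ext) : ext :=
  ((x.1^-1)%g, - (x.2 + gam x.1^-1 x.1 + gam 1 1) *m rG (x.1^-1)%g).

Lemma ext_mulA : associative ext_mul.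
Proof.
move=> [f u] [g v] [h w]; congr (_, _); rewrite /= ?mulgA //.
rewrite repr_mx_mul !mulmxDl mulmxA.
have /eqP := gamP f g h; rewrite addrC -subr_eq => /eqP <-.
move: (u *m _ *m _) (v *m _) (gam f g *m _) => u' v' z.
by apply/rowP=> j; rewrite !mxE; ring.
Qed.

Lemma ext_mul1 : left_id ext_one ext_mul.
Proof.
move=> [g v]; congr (_, _); rewrite /= ?mul1g //.
by rewrite mulNmx gam1l addrAC addNr add0r.
Qed.

Lemma ext_mulV : left_inverse ext_one ext_inv ext_mul.
Proof.
move=> [g v]; congr (_, _); rewrite /= ?mulVg //.
rewrite -mulmxA -repr_mx_mul mulVg repr_mx1 mulmx1.
by apply/rowP=> j; rewrite !mxE; ring.
Qed.

HB.instance Definition _ :=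
  Finite_isGroup.Build ext ext_mulA ext_mul1 ext_mulV.

(* The identification of V with the kernel of ext -> H; the shift accounts for
   cocycles that are not normalized. *)
Definition iota (v : 'rV['F_p]_d) : ext := (1%g, v - gam 1 1).

Lemma iotaD v w : iota (v + w) = (iota v * iota w)%g.
Proof.
apply/eqP; rewrite eqE /= mulg1 eqxx /= repr_mx1 mulmx1; apply/eqP.
by apply/rowP=> j; rewrite !mxE; ring.
Qed.

Section Evaluation.
Variables (e : nat) (h : 'I_e -> gT).

Definition eletter (x : letter e d) : ext :=
  match x with
  | inl (i, s) =>
      let u : ext := (h i, 0) in
      if s || (#[h i]%g == 2%N) then u else (u^-1)%g
  | inr j => iota (vbase j)
  end.

Definition evalE (w : seq (letter e d)) : ext := (\prod_(x <- w) eletter x)%g.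

Definition holds (lr : rule (letter e d)) : bool := evalE lr.1 == evalE lr.2.

End Evaluation.
End Extension.

Section Xi.
Variables (e : nat) (h : 'I_e -> gT) (RH : seq (rule (aletter e))).

Definition xi (c : subvs_of Z2) : tuples h RH :=
  odflt 0 [pick y : tuples h RH | all (holds c h) (RHy y)].

Lemma iota_prod c (I : Type) (r : seq I) (F : I -> 'rV['F_p]_d) :
  iota c (\sum_(i <- r) F i) = (\prod_(i <- r) iota c (F i))%g.
Proof.
elim: r => [|i r IHr]; last by rewrite !big_cons iotaD IHr.
by rewrite !big_nil /iota add0r.
Qed.

Lemma evalE_cat c u v :
  evalE c h (u ++ v) = (evalE c h u * evalE c h v)%g.
Proof. by rewrite /evalE big_cat. Qed.

Lemma evalE_bword c f : evalE c h (bword e f) = iota c f.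
Proof.
rewrite {2}[f]row_sum_delta -big_enum /= iota_prod /evalE big_flatten big_map.
apply: eq_bigr => j _; rewrite big_nseq /= -[in RHS](natr_Zp (f 0 j)).
elim: {f}(f 0 j : nat) => [|n IHn] /=; first by rewrite scale0r /iota add0r.
by rewrite IHn -iotaD mulrS scalerDl scale1r.
Qed.

Lemma evalE_fst c w : (evalE c h (abword d w)).1 = evalH h w.
Proof.
elim: w => [|[i s] w IHw]; first by rewrite /evalE /evalH !big_nil.
rewrite /evalE /evalH /= !big_cons -/(evalH h w) -IHw /=; congr mulg.
rewrite /hletter /=; case: ifP => /=; case: s => //= /eqP hi2.
by apply/eqP; rewrite eq_sym eq_invg_mul -expg2 -hi2 expg_order.
Qed.

Lemma evalE_snd a c c' w :
  (evalE (a *: c + c') h (abword d w)).2 =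
  a *: (evalE c h (abword d w)).2 + (evalE c' h (abword d w)).2.
Proof.
have gamD g k : gam (a *: c + c') g k = a *: gam c g k + gam c' g k.
  by rewrite /gam linearP !ffunE.
elim: w => [|x w IHw].
  by rewrite /evalE !big_nil /= gamD scalerN opprD.
have evalS b : evalE b h (abword d (x :: w)) =
    ext_mul (eletter b h (inl x)) (evalE b h (abword d w)).
  by rewrite /evalE /= big_cons.
rewrite !evalS /ext_mul /= IHw !evalE_fst gamD.
have fst_eq b : (eletter b h (inl x)).1 = (eletter c h (inl x)).1.
  by case: x {IHw evalS} => i s /=; case: ifP.
have snd_eq : (eletter (a *: c + c') h (inl x)).2 =
    a *: (eletter c h (inl x)).2 + (eletter c' h (inl x)).2.
  case: x {IHw evalS fst_eq} => i s /=; case: ifP => _ /=.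
    by rewrite scaler0 addr0.
  rewrite !add0r !gamD !scalemxAl -mulmxDl; congr (_ *m _).
  by apply/rowP=> j; rewrite !mxE; ring.
rewrite !fst_eq ?(fst_eq c') snd_eq mulmxDl -scalemxAl.
move: (_ *m _) (_ *m _) => u v.
by apply/rowP=> j; rewrite !mxE; ring.
Qed.

Let lhs i := (tnth (in_tuple (RHtilde h RH)) i).1.
Let rhs i := (tnth (in_tuple (RHtilde h RH)) i).2.

Lemma holds_RHy c (y : tuples h RH) :
  reflect (forall i, evalH h (lhs i) = evalH h (rhs i) /\
             row i y = (evalE c h (abword d (lhs i))).2
                       - (evalE c h (abword d (rhs i))).2)
          (all (holds c h) (RHy y)).
Proof.
have holdsE i :
    holds c h (abword d (lhs i), abword d (rhs i) ++ bword e (row i y)) =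
    (evalH h (lhs i) == evalH h (rhs i)) &&
    (row i y == (evalE c h (abword d (lhs i))).2
                - (evalE c h (abword d (rhs i))).2).
  rewrite /holds /= evalE_cat evalE_bword eqE /= !evalE_fst mulg1.
  rewrite repr_mx1 mulmx1 gam1r addrA subrK; congr (_ && _).
  by rewrite eq_sym addrC -[LHS](inj_eq (addIr (- (evalE c h (abword d (rhs i))).2))) addrK.
rewrite /RHy all_map; apply: (iffP allP) => [H i | H i _ /=].
  have := H i (mem_enum _ i); rewrite /= holdsE => /andP[/eqP-> /eqP->].
  by [].
by rewrite holdsE; have [-> ->] := H i; rewrite !eqxx.
Qed.

Let xival c : tuples h RH :=
  \matrix_i ((evalE c h (abword d (lhs i))).2
             - (evalE c h (abword d (rhs i))).2).

Lemma holds_xival c (y : tuples h RH) :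
  (forall i, evalH h (lhs i) = evalH h (rhs i)) ->
  all (holds c h) (RHy y) = (y == xival c).
Proof.
move=> evH; apply/holds_RHy/eqP => [H | -> i]; last by rewrite rowK.
by apply/row_matrixP=> i; rewrite rowK; case: (H i).
Qed.

Lemma xi_is_linear : linear xi.
Proof.
case: (boolP [forall i, evalH h (lhs i) == evalH h (rhs i)]).
  move/forallP=> evH.
  have xiE c : xi c = xival c.
    have evH' i : evalH h (lhs i) = evalH h (rhs i) by exact/eqP.
    rewrite /xi; case: pickP => [y | /(_ (xival c))] /=.
      by rewrite holds_xival // => /eqP.
    by rewrite holds_xival // eqxx.
  move=> a c c'; rewrite !xiE; apply/matrixP=> i j.
  by rewrite /xival !mxE !evalE_snd !mxE; ring.
rewrite negb_forall => /existsP[i /eqP evHi].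
have xiE c : xi c = 0.
  by rewrite /xi; case: pickP => [y /holds_RHy/(_ i)[] | ].
by move=> a c c'; rewrite !xiE scaler0 addr0.
Qed.
HB.instance Definition _ :=
  GRing.isSemilinear.Build 'F_p (subvs_of Z2) (tuples h RH) _ xi
    (GRing.semilinear_linear xi_is_linear).

Lemma xiP c (y : tuples h RH) :
  (forall l r, (l, r) \in RH -> evalH h l = evalH h r) ->
  all (holds c h) (RHy y) <-> y = xi c.
Proof.
move=> evRH.
have evH i : evalH h (lhs i) = evalH h (rhs i).
  apply: evRH; rewrite /lhs /rhs -surjective_pairing.
  by have := mem_tnth i (in_tuple (RHtilde h RH)); rewrite mem_filter => /andP[].
rewrite holds_xival //.
suff -> : xi c = xival c by split=> /eqP.
rewrite /xi; case: pickP => [y' | /(_ (xival c))] /=; rewrite holds_xival ?eqxx //.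
by move/eqP.
Qed.

Definition xi_hom : 'Hom(subvs_of Z2, tuples h RH) := linfun xi.

Definition xiZ2 : {vspace tuples h RH} := limg xi_hom.

Definition B2_in_Z2 : {vspace subvs_of Z2} :=
  (linfun (@vsval _ _ Z2) @^-1: B2)%VS.

Definition xiB2 : {vspace tuples h RH} := (xi_hom @: B2_in_Z2)%VS.

End Xi.
End Module.

Section Quotient.
Variables (K : fieldType) (vT : vectType K).

Variables U W : {vspace vT}.

(* The quotient of U by U :&: W, that is U / W when W is a subspace of U. *)
Definition vquot : Type :=
  Quotient.quot (pred_of_vspace (linfun (@vsval _ _ U) @^-1: W)%VS).

HB.instance Definition _ := GRing.Zmodule.on vquot.
HB.instance Definition _ := EqQuotient.on vquot.

Definition vclass (u : subvs_of U) : vquot := \pi_vquot%qT u.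
Definition vrep (x : vquot) : subvs_of U := generic_quotient.repr x.

Lemma vrepK : cancel vrep vclass.
Proof. exact: reprK. Qed.

Lemma vclassP u v : reflect (vclass u = vclass v) (vsval (u - v) \in W).
Proof.
suff -> : (vsval (u - v) \in W) = (vclass u == vclass v) by exact: eqP.
rewrite /vclass -[RHS]Quotient.idealrBE.
by rewrite -[RHS]/(u - v \in (linfun (@vsval _ _ U) @^-1: W)%VS) -memv_preim lfunE.
Qed.

Lemma vclassD u v : vclass (u + v) = vclass u + vclass v.
Proof. exact: Quotient.pi_add. Qed.

Definition vquot_scale (a : K) (x : vquot) : vquot := vclass (a *: vrep x).

Lemma vclassZ a u : vclass (a *: u) = vquot_scale a (vclass u).
Proof.
apply/vclassP; rewrite -scalerBr linearZ memvZ //.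
by apply/vclassP; rewrite vrepK.
Qed.

Lemma vquot_scaleA a b x :
  vquot_scale a (vquot_scale b x) = vquot_scale (a * b) x.
Proof. by rewrite -[x]vrepK -!vclassZ scalerA. Qed.

Lemma vquot_scale1 : left_id 1 vquot_scale.
Proof. by move=> x; rewrite -[x]vrepK -vclassZ scale1r. Qed.

Lemma vquot_scaleDr : right_distributive vquot_scale +%R.
Proof.
move=> a x y; rewrite -[x]vrepK -[y]vrepK -vclassD -!vclassZ scalerDr.
exact: vclassD.
Qed.

Lemma vquot_scaleDl x : {morph vquot_scale^~ x : a b / a + b}.
Proof.
by move=> a b; rewrite -[x]vrepK -!vclassZ scalerDl vclassD.
Qed.

HB.instance Definition _ := GRing.Zmodule_isLmodule.Build K vquot
  vquot_scaleA vquot_scale1 vquot_scaleDr vquot_scaleDl.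

End Quotient.

(* Main.v *)
From HB Require Import structures.
From Stdlib Require Import Relations Classical_Prop.
Require Import Defs.
From mathcomp Require Import all_boot all_order all_algebra.
From mathcomp Require Import all_fingroup all_solvable all_field all_character.

Set Implicit Arguments.
Unset Strict Implicit.
Unset Printing Implicit Defensive.

Import GRing.Theory.
Local Open Scope ring_scope.

(** Idea: R(y) rewrites every word to the form u b^f with u
    irreducible for R_H, and is confluent exactly when u and f are unique.
    If R(y) is confluent, the products s(g) s(k) = s(gk) b^gamma(g,k) of a section
    s : H -> words define gamma, associativity of concatenation is the cocycle
    identity, and w |-> s(g) b^f identifies the presented monoid with E_gamma, so
    that y = xi(gamma).  Conversely, if y = xi(gamma), then evaluation in E_gamma
    is invariant under R(y) and separates the words u b^f.  Finally, xi(gamma) = 0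
    says that evaluation of words in the a_i factors through H, i.e. that the
    extension splits. *)

(** * Congruences, the Church-Rosser property and normal forms of word rewriting *)

Section RewritingTheory.
Variables (L : eqType) (R : seq (seq L * seq L)).

Definition irreducible_word (u : seq L) : Prop := forall v, ~ rstep R u v.

Lemma rsteps_trans u v w : rsteps R u v -> rsteps R v w -> rsteps R u w.
Proof. exact: rt_trans. Qed.

Lemma requiv_trans u v w : requiv R u v -> requiv R v w -> requiv R u w.
Proof. exact: rst_trans. Qed.

Lemma rsteps_rule l r : (l, r) \in R -> rsteps R l r.
Proof.
by move=> lrR; apply: rt_step; exists [::], [::], l, r; rewrite /= !cats0.
Qed.

Lemma rstep_ctx x y u v : rstep R u v -> rstep R (x ++ u ++ y) (x ++ v ++ y).
Proof.
case=> [x' [y' [l [r [lrR -> ->]]]]].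
by exists (x ++ x'), (y' ++ y), l, r; rewrite !catA.
Qed.

Lemma rsteps_ctx x y u v : rsteps R u v -> rsteps R (x ++ u ++ y) (x ++ v ++ y).
Proof.
elim=> [u' v' /rstep_ctx st | u' | u' v' w' _ IH1 _ IH2].
- exact: rt_step.
- exact: rt_refl.
- exact: rsteps_trans IH1 IH2.
Qed.

Lemma requiv_ctx x y u v : requiv R u v -> requiv R (x ++ u ++ y) (x ++ v ++ y).
Proof.
elim=> [u' v' /rstep_ctx st | u' | u' v' _ IH | u' v' w' _ IH1 _ IH2].
- exact: rst_step.
- exact: rst_refl.
- exact: rst_sym.
- exact: requiv_trans IH1 IH2.
Qed.

Lemma rsteps_cat u u' v v' :
  rsteps R u u' -> rsteps R v v' -> rsteps R (u ++ v) (u' ++ v').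
Proof.
move=> /(rsteps_ctx [::] v) /= uu' /(rsteps_ctx u' [::]).
by rewrite !cats0; apply: rsteps_trans.
Qed.

Lemma requiv_cat u u' v v' :
  requiv R u u' -> requiv R v v' -> requiv R (u ++ v) (u' ++ v').
Proof.
move=> /(requiv_ctx [::] v) /= uu' /(requiv_ctx u' [::]).
by rewrite !cats0; apply: requiv_trans.
Qed.

Lemma rsteps_catl x u v : rsteps R u v -> rsteps R (x ++ u) (x ++ v).
Proof. by apply: rsteps_cat; apply: rt_refl. Qed.

Lemma rsteps_catr y u v : rsteps R u v -> rsteps R (u ++ y) (v ++ y).
Proof. by move=> uv; apply: rsteps_cat => //; apply: rt_refl. Qed.

Lemma requiv_catl x u v : requiv R u v -> requiv R (x ++ u) (x ++ v).
Proof. by apply: requiv_cat; apply: rst_refl. Qed.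

Lemma requiv_catr y u v : requiv R u v -> requiv R (u ++ y) (v ++ y).
Proof. by move=> uv; apply: requiv_cat => //; apply: rst_refl. Qed.

Lemma rsteps_requiv u v : rsteps R u v -> requiv R u v.
Proof. exact: clos_rt_clos_rst. Qed.

(** Serves twice: for all letters evaluated in $E_\gamma$, and for the [a]-letters alone when the
    cocycle lies in the kernel of [xi]. *)
Lemma requiv_prodg (G : groupType) (f : L -> G) u v :
    (forall l r, (l, r) \in R ->
       \prod_(x <- l) f x = \prod_(x <- r) f x)%g ->
  requiv R u v -> (\prod_(x <- u) f x = \prod_(x <- v) f x)%g.
Proof.
move=> fR; elim=> [_ _ [x [y [l [r [/fR lr -> ->]]]]] | // | // | ].
  by rewrite !big_cat /= lr.
by move=> x y z _ -> _ ->.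
Qed.

Lemma irreducible_rsteps u v : irreducible_word u -> rsteps R u v -> v = u.
Proof. by move=> iu uv; case: (clos_rt_rt1n _ _ _ _ uv) iu => // w z uw _ /(_ w). Qed.

Lemma church_rosser u v : confluent R -> requiv R u v ->
  exists2 w, rsteps R u w & rsteps R v w.
Proof.
move=> cR; elim=> [u' v' st | u' | u' v' _ [w]| u' v' w' _ [x ux vx] _ [z vz wz]].
- by exists v'; [apply: rt_step | apply: rt_refl].
- by exists u'; apply: rt_refl.
- by exists w.
have [t xt zt] := cR _ _ _ vx vz.
by exists t; [apply: rsteps_trans ux xt | apply: rsteps_trans wz zt].
Qed.

Lemma irreducible_unique u v : confluent R ->
  irreducible_word u -> irreducible_word v -> requiv R u v -> u = v.
Proof.
move=> cR iu iv /(church_rosser cR)[w /(irreducible_rsteps iu) + ].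
by move=> /[swap] /(irreducible_rsteps iv) ->.
Qed.

Lemma rstep_decr lt u v :
  reduction_order lt -> rewriting_system lt R -> rstep R u v -> lt v u.
Proof. by case=> _ _ ltC decR [x [y [l [r [/decR rl -> ->]]]]]; apply: ltC. Qed.

Lemma normal_form_exists lt u :
  reduction_order lt -> rewriting_system lt R ->
  exists2 v, irreducible_word v & rsteps R u v.
Proof.
move=> ltR decR; have [_ wf _] := ltR.
elim/(well_founded_ind wf): u => u IH.
have [[v uv] | nred] := classic (exists v, rstep R u v).
  have [w iw vw] := IH v (rstep_decr ltR decR uv).
  by exists w => //; apply: rsteps_trans vw; apply: rt_step.
by exists u; [move=> v uv; case: nred; exists v | apply: rt_refl].
Qed.

End RewritingTheory.

(** * The ordering on words in the [b]-letters *)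

Section Orientation.
Variable d : nat.

(** This is [blt] over an arbitrary list of symbols in place of [enum 'I_d], to allow induction on
    the list. *)
Let bfold (s : seq 'I_d) : seq 'I_d -> seq 'I_d -> Prop :=
  foldr (fun j lt =>
           wreath (fun x => if x == j then inl tt else inr x) lt
                  (@length_lt unit))
        (fun _ _ => False) s.

Lemma uppers_lower (T K L : Type) (split : T -> K + L) (t : seq T) :
  all (fun x => ~~ isSome (if split x is inl k then Some k else None)) t ->
  uppers split t = [::].
Proof. by elim: t => //= x t IH; case: (split x). Qed.

(** Each symbol of [s] before [j] sees both words as a single lower block, so the comparison
    descends to the level of [j], where the lengths [0 < n] decide. *)
Lemma bfold_nil (s : seq 'I_d) j n :
  j \in s -> (0 < n)%N -> bfold s [::] (nseq n j).
Proof.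
move=> + n0; elim: s => //= k s IH; rewrite inE.
have [<- _ | njk /= js] := eqVneq j k.
  left; rewrite /= /length_lt; case: n n0 {IH} => //= n _.
  by rewrite /uppers /= eqxx.
right.
have upE : uppers (fun x => if x == k then inl tt else inr x) (nseq n j) = [::].
  by apply: uppers_lower; rewrite all_nseq (negPf njk) orbT.
have loE : lowers (fun x => if x == k then inl tt else inr x) (nseq n j)
           = [:: nseq n j].
  by elim: n {n0 IH upE} => //= n ->; rewrite (negPf njk).
by rewrite upE loE; split=> //=; left; apply: IH.
Qed.

(** The level of [i] comes before that of [j]. There both words have the one upper letter [i], and
    their first lower blocks, empty and [[:: j]], decide. *)
Lemma bfold_swap (s : seq 'I_d) i j :
    sorted (fun x y : 'I_d => x < y)%N s -> i \in s -> j \in s -> (i < j)%N ->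
  bfold s [:: i; j] [:: j; i].
Proof.
move=> + + + ij; have nij : i != j by apply: contraTneq ij => ->; rewrite ltnn.
elim: s => //= k s IH pth; rewrite !inE.
have ks : forall x, x \in s -> (k < x)%N.
  apply/allP; apply: order_path_min pth => x y z; exact: ltn_trans.
have [ik | nik /= is_] := eqVneq i k.
  rewrite -ik eq_sym (negPf nij) /= => _ js; right.
  rewrite /uppers /= eqxx eq_sym (negPf nij) /=; split=> //; left.
  exact: (@bfold_nil s j 1).
have [jk | njk /= js] := eqVneq j k.
  by have := ks _ is_; rewrite -jk ltnNge ltnW.
right; rewrite /uppers /= (negPf nik) (negPf njk) /=; split=> //; left.
exact: IH (path_sorted pth) is_ js.
Qed.

Lemma blt_nil j n : (0 < n)%N -> blt [::] (nseq n (j : 'I_d)).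
Proof. by apply: bfold_nil; rewrite mem_enum. Qed.

Lemma blt_swap (i j : 'I_d) : (i < j)%N -> blt [:: i; j] [:: j; i].
Proof.
apply: bfold_swap; rewrite ?mem_enum //.
by have := iota_ltn_sorted 0 d; rewrite -val_enum_ord sorted_map.
Qed.

(** * The words $b^f$ among the words over both alphabets *)

Variable e : nat.

Lemma uppers_abword (u : seq (aletter e)) : uppers id (abword d u) = u.
Proof. by rewrite /uppers /abword; elim: u => //= x u ->. Qed.

Lemma uppers_cat (w w' : seq (letter e d)) :
  uppers id (w ++ w') = uppers id w ++ uppers id w'.
Proof. exact: pmap_cat. Qed.

Lemma uppers_inr (t : seq 'I_d) : uppers id (map inr t : seq (letter e d)) = [::].
Proof. by rewrite /uppers; elim: t. Qed.

Lemma lowers_inr (t : seq 'I_d) :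
  lowers id (map inr t : seq (letter e d)) = [:: t].
Proof. by elim: t => //= j t ->. Qed.

Definition bseq p (f : 'rV['F_p]_d) : seq 'I_d :=
  flatten [seq nseq (f 0 j) j | j <- enum 'I_d].

Lemma bwordE p (f : 'rV['F_p]_d) : bword e f = map inr (bseq f).
Proof.
rewrite /bword /bseq map_flatten -map_comp; congr flatten.
by apply: eq_map => j /=; rewrite map_nseq.
Qed.

Lemma uppers_bword p (f : 'rV['F_p]_d) : uppers id (bword e f) = [::].
Proof. by rewrite bwordE uppers_inr. Qed.

Lemma bword0 p : bword e (0 : 'rV['F_p]_d) = [::].
Proof.
by rewrite /bword; elim: (enum _) => //= j s ->; rewrite mxE.
Qed.

Lemma count_bseq p (f : 'rV['F_p]_d) j : count_mem j (bseq f) = f 0 j :> nat.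
Proof.
rewrite /bseq count_flatten -map_comp sumnE big_map big_enum /=.
rewrite (bigD1 j) //= count_nseq /= eqxx mul1n big1 ?addn0 // => i nij.
by rewrite count_nseq /= (negPf nij) mul0n.
Qed.

Lemma bword_inj p : injective (@bword e p d).
Proof.
move=> f f'; rewrite !bwordE => /(inj_map (@inr_inj _ _)) E.
by apply/rowP=> j; have := count_bseq f j; rewrite E count_bseq => /val_inj.
Qed.

(** Lets an induction on the word [bseq f] replace one on the exponent vector [f]. *)
Lemma sum_bseq p (f : 'rV['F_p]_d) : \sum_(j <- bseq f) vbase p j = f.
Proof.
rewrite {2}[f]row_sum_delta -big_enum /= /bseq big_flatten big_map.
apply: eq_bigr => j _; rewrite big_nseq iter_addr addr0.
by rewrite -scaler_nat natr_Zp.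
Qed.

End Orientation.

(** * Rewriting with the rules of $R(y)$ for arbitrary $y$ *)

Section ExtendedSystem.
Variables (gT : finGroupType) (e : nat) (h : 'I_e -> gT).
Variable RH : seq (rule (aletter e)).
Variables (p d : nat) (rG : mx_representation 'F_p [set: gT] d).
Variable y : tuples p d h RH.
Hypothesis p_prime : prime p.

Local Notation D := (Ry rG y).
Local Notation lhs i := (tnth (in_tuple (RHtilde h RH)) i).1.
Local Notation rhs i := (tnth (in_tuple (RHtilde h RH)) i).2.

Variant Ry_spec : rule (letter e d) -> Prop :=
| RyTilde i : Ry_spec (abword d (lhs i), abword d (rhs i) ++ bword e (row i y))
| RyPower j : Ry_spec (nseq p (inr j), [::])
| RySwap (i j : 'I_d) of (i < j)%N :
    Ry_spec ([:: inr j; inr i], [:: inr i; inr j])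
| RyModule j x :
    Ry_spec ([:: inr j; inl x],
             inl x :: bword e (vbase p j *m rG (hletter h x)))
| RyBar l r of (l, r) \in RHbar h : Ry_spec (abword d l, abword d r).

Lemma RyP lr : reflect (Ry_spec lr) (lr \in D).
Proof.
apply: (iffP idP).
  rewrite /Ry !mem_cat => /or3P[/mapP[i _ ->] | /orP[] | /orP[]].
  - exact: RyTilde.
  - by case/mapP=> j _ ->; apply: RyPower.
  - case/mapP=> -[j i]; rewrite mem_filter /= => /andP[ij _] ->.
    exact: RySwap.
  - by case/mapP=> -[j x] _ ->; apply: RyModule.
  - by case/mapP=> -[l r] lr_in ->; apply: RyBar.
case=> [i | j | i j ij | j x | l r lr_in]; rewrite !mem_cat.
- by rewrite map_f ?mem_enum.
- by rewrite (map_f (fun j => (nseq p (inr j), [::]))) ?mem_enum ?orbT.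
- apply/or4P; constructor 2; apply/orP; right.
  by apply/mapP; exists (j, i); rewrite // mem_filter mem_enum /= ij.
- apply/or4P; constructor 3.
  by apply/mapP; exists (j, x); rewrite // mem_enum.
- apply/or4P; constructor 4.
  by apply/mapP; exists (l, r).
Qed.

Lemma RHtilde_mem i : (lhs i, rhs i) \in RH.
Proof.
rewrite -surjective_pairing.
by have := mem_tnth i (in_tuple (RHtilde h RH)); rewrite mem_filter => /andP[].
Qed.

Lemma RHbar_mem l r : has_inverse_rules h RH -> (l, r) \in RHbar h -> (l, r) \in RH.
Proof.
move=> hinv /flattenP[_ /mapP[i _ ->]]; have := hinv i.
case: ifP => _ [H1 H2]; rewrite !inE; first by move/eqP->.
by case/orP=> /eqP ->.
Qed.

Lemma val_succ_Fp (x : 'F_p) : (1 + x : 'F_p) = (x.+1 %% p)%N :> nat.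
Proof. by rewrite -{1}[x]natr_Zp -mulrS val_Fp_nat. Qed.

Lemma ltn_Fp (x : 'F_p) : (x < p)%N.
Proof. by have := ltn_ord x; rewrite [X in (_ < X)%N]Fp_cast. Qed.

(** Swaps carry $b_j$ past the blocks of smaller letters to its own block; if that block then has
    length [p], the power rule erases it. *)
Lemma rsteps_insert (f : 'rV['F_p]_d) j :
  rsteps D (inr j :: bword e f) (bword e (vbase p j + f)).
Proof.
pose B (g : 'rV['F_p]_d) (s : seq 'I_d) : seq (letter e d) :=
  flatten [seq nseq (g 0 i) (inr i) | i <- s].
suff ins s : sorted (fun x y : 'I_d => x < y)%N s -> j \in s ->
    rsteps D (inr j :: B f s) (B (vbase p j + f) s).
  apply: ins; last by rewrite mem_enum.
  by have := iota_ltn_sorted 0 d; rewrite -val_enum_ord sorted_map.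
elim: s => //= k s IH pth; rewrite inE.
have ks : forall x, x \in s -> (k < x)%N.
  apply/allP; apply: order_path_min pth => x y' z; exact: ltn_trans.
have entry i : i != j -> (vbase p j + f) 0 i = f 0 i.
  by move=> nij; rewrite !mxE (negPf nij) andbF add0r.
have [jk _ | njk /= js] := eqVneq j k; last first.
  rewrite /B /= entry 1?eq_sym // -/(B _ _) -/(B _ _).
  apply: rsteps_trans (rsteps_catl _ (IH (path_sorted pth) js)).
  elim: (f 0 k : nat) => [|n IHn] /=; first exact: rt_refl.
  apply: rsteps_trans (rsteps_catl [:: inr k] IHn).
  apply: (rsteps_catr _ (u := [:: inr j; inr k]) (v := [:: inr k; inr j])).
  by apply/rsteps_rule/RyP/RySwap/ks.
rewrite -{}jk {k} in pth ks *.
have BE : B (vbase p j + f) s = B f s.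
  rewrite /B; congr flatten; apply/eq_in_map => i /ks ji.
  by rewrite entry // eq_sym; apply: contraTneq ji => ->; rewrite ltnn.
rewrite /B /= -/(B _ _) -/(B _ _) BE.
apply: (rsteps_catr _ (u := inr j :: nseq _ _)).
have -> : (vbase p j + f) 0 j = 1 + f 0 j by rewrite !mxE !eqxx.
rewrite val_succ_Fp -[inr j :: _]/(nseq (f 0 j).+1 (inr j)).
have [lt | ge] := ltnP (f 0 j).+1 p; first by rewrite modn_small //; apply: rt_refl.
have -> : (f 0 j).+1 = p by apply/eqP; rewrite eqn_leq ge ltn_Fp.
by rewrite modnn; apply/rsteps_rule/RyP/RyPower.
Qed.

Lemma rsteps_sort (t : seq 'I_d) :
  rsteps D (map inr t) (bword e (\sum_(j <- t) vbase p j)).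
Proof.
elim: t => [|j t IH]; first by rewrite big_nil bword0; apply: rt_refl.
rewrite big_cons; apply: rsteps_trans (rsteps_insert _ _).
exact: (rsteps_catl [:: inr j]).
Qed.

Lemma rsteps_bwordD (f f' : 'rV['F_p]_d) :
  rsteps D (bword e f ++ bword e f') (bword e (f + f')).
Proof.
rewrite -{2}(sum_bseq f) -{2}(sum_bseq f') -big_cat !bwordE -map_cat -bwordE.
exact: rsteps_sort.
Qed.

Lemma rsteps_bword_letter (f : 'rV['F_p]_d) x :
  rsteps D (bword e f ++ [:: inl x]) (inl x :: bword e (f *m rG (hletter h x))).
Proof.
rewrite -{2}(sum_bseq f) bwordE; elim: (bseq f) => [|j t IH] /=.
  by rewrite big_nil mul0mx bword0; apply: rt_refl.
apply: rsteps_trans (rsteps_catl [:: inr j] IH) _.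
rewrite big_cons mulmxDl.
apply: rsteps_trans (rsteps_catl [:: inl x] (rsteps_bwordD _ _)).
apply: (rsteps_catr _ (u := [:: inr j; inl x]) (v := inl x :: bword _ _)).
exact/rsteps_rule/RyP/RyModule.
Qed.

Lemma rsteps_bword_abword (f : 'rV['F_p]_d) u :
  rsteps D (bword e f ++ abword d u) (abword d u ++ bword e (f *m rG (evalH h u))).
Proof.
elim: u f => [|x u IH] f /=.
  by rewrite cats0 /evalH big_nil repr_mx1 mulmx1; apply: rt_refl.
rewrite -cat1s catA; apply: rsteps_trans (rsteps_catr _ (rsteps_bword_letter _ _)) _.
rewrite /evalH big_cons repr_mx_mul mulmxA.
exact: (rsteps_catl [:: inl x] (IH _)).
Qed.

(** This is the product of $E_\gamma$ without its cocycle term, which appears only once [u ++ v] is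
    reduced by rules of $R_H$. *)
Lemma rsteps_mul u f v g :
  rsteps D ((abword d u ++ bword e f) ++ (abword d v ++ bword e g))
           (abword d (u ++ v) ++ bword e (f *m rG (evalH h v) + g)).
Proof.
rewrite /abword map_cat -!catA; apply: rsteps_catl.
rewrite catA; apply: rsteps_trans (rsteps_catr _ (rsteps_bword_abword _ _)) _.
by rewrite -catA; apply/rsteps_catl/rsteps_bwordD.
Qed.

Lemma rsteps_split w :
  exists u (f : 'rV['F_p]_d), rsteps D w (abword d u ++ bword e f).
Proof.
elim: w => [|[x|j] w [u [f IH]]].
- by exists [::], 0; rewrite bword0; apply: rt_refl.
- by exists (x :: u), f; apply: (rsteps_catl [:: inl x]).
exists u; exists (vbase p j *m rG (evalH h u) + f).
apply: rsteps_trans (rsteps_catl [:: inr j] IH) _.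
apply: rsteps_trans (rsteps_mul [::] _ u f).
apply: (rsteps_catr _ (u := [:: inr j])).
by have := rsteps_sort [:: j]; rewrite big_seq1.
Qed.

Lemma rsteps_lift_rule l r : (l, r) \in RH ->
  exists c : 'rV['F_p]_d, rsteps D (abword d l) (abword d r ++ bword e c).
Proof.
move=> lrRH; have [lrbar | nlrbar] := boolP ((l, r) \in RHbar h).
  by exists 0; rewrite bword0 cats0; apply/rsteps_rule/RyP/RyBar.
have /tnthP[i lri] : (l, r) \in in_tuple (RHtilde h RH) by rewrite mem_filter nlrbar.
exists (row i y); apply/rsteps_rule/RyP.
by have := RyTilde i; rewrite -lri.
Qed.

Lemma rsteps_lift_rstep u v : rstep RH u v ->
  exists c : 'rV['F_p]_d, rsteps D (abword d u) (abword d v ++ bword e c).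
Proof.
case=> x [z [l [r [/rsteps_lift_rule[c lr] -> ->]]]].
(* The correction [c] has to cross the right context [z], whose value in $H$ acts on it. *)
exists (c *m rG (evalH h z)).
rewrite /abword !map_cat -!catA; apply: rsteps_catl.
apply: rsteps_trans (rsteps_catr _ lr) _; rewrite -catA; apply: rsteps_catl.
exact: rsteps_bword_abword.
Qed.

Lemma requiv_lift u v : requiv RH u v ->
  exists c : 'rV['F_p]_d, requiv D (abword d u) (abword d v ++ bword e c).
Proof.
elim=> [u' v' /rsteps_lift_rstep[c st] | u' | u' v' _ [c uv] |
        u' v' w' _ [c uv] _ [c' vw]].
- by exists c; apply: rsteps_requiv.
- by exists 0; rewrite bword0 cats0; apply: rst_refl.
(* Reversing the congruence moves $b^c$ to the other side, where $b^{-c}$ cancels it. *)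
- exists (- c); apply: rst_sym.
  apply: requiv_trans (requiv_catr _ uv) _; rewrite -catA -[X in requiv _ _ X]cats0.
  apply: requiv_catl; rewrite -(bword0 d e p) -(subrr c).
  exact/rsteps_requiv/rsteps_bwordD.
exists (c' + c); apply: requiv_trans uv _.
apply: requiv_trans (requiv_catr _ vw) _; rewrite -catA.
exact/requiv_catl/rsteps_requiv/rsteps_bwordD.
Qed.

(** Normal words are pairwise ordered for this relation, under which all [a]-letters are equivalent;
    the left-hand sides of the swap and module rules violate it. *)
Definition letter_le (x z : letter e d) : bool :=
  match x, z with
  | inl _, _ => true
  | inr _, inl _ => false
  | inr i, inr j => (i <= j)%N
  end.

Lemma pairwise_bseq (f : 'rV['F_p]_d) : pairwise (fun i j : 'I_d => i <= j)%N (bseq f).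
Proof.
have: pairwise (fun x y : 'I_d => x < y)%N (enum 'I_d).
  rewrite -sorted_pairwise; last by move=> ? ? ?; apply: ltn_trans.
  by have := iota_ltn_sorted 0 d; rewrite -val_enum_ord sorted_map.
rewrite /bseq; elim: (enum _) => //= k s IH /andP[/allP ks /IH sP].
rewrite pairwise_cat sP andbT; apply/andP; split.
  apply/allrelP=> x z /nseqP[-> _] /flattenP[_ /mapP[i /ks ki ->] /nseqP[-> _]].
  exact: ltnW.
by elim: (f 0 k : nat) => //= n ->; rewrite andbT; apply/allP=> x /nseqP[->].
Qed.

Lemma pairwise_letter_le u (f : 'rV['F_p]_d) :
  pairwise letter_le (abword d u ++ bword e f).
Proof.
rewrite pairwise_cat bwordE [pairwise _ (map _ (bseq f))]pairwise_map pairwise_bseq andbT.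
apply/andP; split; first by apply/allrelP=> _ z /mapP[x _ ->].
by elim: u => //= x u ->; rewrite andbT; apply/allP.
Qed.

(** A left-hand side in [a]-letters would already reduce [u]; a power $b_j^p$ is excluded because
    exponents are below [p], and the swap and module rules by [letter_le]. *)
Lemma irreducible_normal_word u (f : 'rV['F_p]_d) : has_inverse_rules h RH ->
  irreducible_word RH u -> irreducible_word D (abword d u ++ bword e f).
Proof.
move=> hinv irru v [x [z [l [r [lrD uE _]]]]].
(* Deleting the [b]-letters turns the occurrence of [l] into an occurrence of [l'] in [u]. *)
have redA l' r' : (l', r') \in RH -> l = abword d l' -> False.
  move=> lr' lE; have := congr1 (uppers id) uE.
  rewrite lE !uppers_cat !uppers_abword uppers_bword cats0 => uE'.
  apply: (irru (uppers id x ++ r' ++ uppers id z)).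
  by exists (uppers id x), (uppers id z), l', r'.
have pwl : pairwise letter_le l.
  by have := pairwise_letter_le u f; rewrite uE !pairwise_cat => /and4P[_ _ _ /andP[]].
have cnt j : (count_mem (inr j) l < p)%N.
  apply: leq_ltn_trans (ltn_Fp (f 0 j)); rewrite -count_bseq.
  have /(congr1 (count_mem (inr j))) := uE; rewrite !count_cat.
  have -> : count_mem (inr j) (abword d u) = 0%N by elim: (u).
  rewrite bwordE count_map add0n => E.
  rewrite (eq_count (a2 := pred1 j)) in E; last by move=> i /=; apply/eqP/eqP=> [[]|->].
  by rewrite E addnCA leq_addr.
move/RyP: lrD; move lrE: (l, r) => lr sp.
case: sp lrE => [i | j | i j ij | j x' | l' r' /(RHbar_mem hinv) lr'] [lE _].
- exact: redA (RHtilde_mem i) lE.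
- by have := cnt j; rewrite lE count_nseq /= eqxx mul1n ltnn.
- by move: pwl; rewrite lE /= andbT leqNgt ij.
- by move: pwl; rewrite lE.
- exact: redA lr' lE.
Qed.

(** Rules that come from $R_H$ decrease the word of [a]-letters, which dominates. The others fix
    that word and decrease the first block of [b]-letters. *)
Lemma Ry_decreasing lta : has_inverse_rules h RH -> rewriting_system lta RH ->
  rewriting_system (ablt lta) D.
Proof.
move=> hinv decRH l r /RyP; move lrE: (l, r) => lr sp.
have decA l' r' (f : 'rV['F_p]_d) : (l', r') \in RH ->
    ablt lta (abword d r' ++ bword e f) (abword d l').
  by move/decRH=> rl; left; rewrite uppers_cat !uppers_abword uppers_bword cats0.
case: sp lrE => [i | j | i j ij | j x' | l' r' /(RHbar_mem hinv) lr'] [-> ->].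
- exact: decA (RHtilde_mem i).
- right; have -> T : nseq p (inr j : T + _) = map inr (nseq p j) by rewrite map_nseq.
  rewrite uppers_inr lowers_inr.
  by split=> //; left; apply: blt_nil; apply: prime_gt0.
- right; split=> //; left; exact: blt_swap.
- right; rewrite bwordE -cat1s uppers_cat uppers_inr; split=> //.
  by left; apply: (@blt_nil _ j 1).
- by rewrite -[abword d r']cats0 -(bword0 d e p); apply: decA.
Qed.

End ExtendedSystem.

(** * Confluent systems and 2-cocycles *)

Section Cocycles.
Variables (gT : finGroupType) (e : nat) (h : 'I_e -> gT).
Variable RH : seq (rule (aletter e)).
Variable lta : seq (aletter e) -> seq (aletter e) -> Prop.
Variables (p d : nat) (rG : mx_representation 'F_p [set: gT] d).
Hypothesis h_inj : injective h.
Hypothesis h_gen : <<[set h i | i : 'I_e]>>%g = [set: gT].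
Hypothesis lta_red : reduction_order lta.
Hypothesis RH_conf : confluent_rewriting_system lta RH.
Hypothesis RH_def : defines (evalH h) RH.
Hypothesis RH_inv : has_inverse_rules h RH.
Hypothesis p_prime : prime p.

Lemma evalH_rule l r : (l, r) \in RH -> evalH h l = evalH h r.
Proof. by move=> /rsteps_rule/rsteps_requiv/RH_def. Qed.

Lemma evalH_cat u v : evalH h (u ++ v) = (evalH h u * evalH h v)%g.
Proof. by rewrite /evalH big_cat. Qed.

(** Since $H$ is finite, products of the generators without inverses already exhaust it. *)
Lemma evalH_surj g : exists u, evalH h u = g.
Proof.
have : g \in <<[set h i | i : 'I_e]>>%g by rewrite h_gen inE.
case/gen_prodgP=> n [c c_h ->]; elim: n c c_h => [|n IH] c c_h.
  by exists [::]; rewrite big_ord0 /evalH big_nil.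
have [u uE] := IH (fun i => c (lift ord0 i)) (fun i => c_h _).
have /imsetP[i _ ci] := c_h ord0.
exists ((i, true) :: u); rewrite big_ord_recl -uE ci.
by rewrite /evalH big_cons.
Qed.

Lemma iota_inj (c : subvs_of (Z2 rG)) : injective (Defs.iota c).
Proof. by move=> u v [/addIr]. Qed.

(** Conjugation in the extension induces the module action on the kernel, which is what makes the
    rules [RM] hold. *)
Lemma iota_mul (c : subvs_of (Z2 rG)) v (q : ext_of c) :
  (Defs.iota c v * q = q * Defs.iota c (v *m rG q.1))%g.
Proof.
case: q => g w; apply/eqP; rewrite eqE /= mulg1 mul1g eqxx /=; apply/eqP.
rewrite mulmxBl repr_mx1 mulmx1 gam1r gam1l.
by rewrite addrAC subrK -addrA subrK addrC.
Qed.

(** * Validity of the rules in $E_\gamma$ *)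

Section Sound.
Variable c : subvs_of (Z2 rG).

Lemma evalE_bar l r : (l, r) \in RHbar h ->
  evalE c h (abword d l) = evalE c h (abword d r).
Proof.
case/flattenP=> _ /mapP[i _ ->]; rewrite /evalE; case: ifP => o2; rewrite !inE.
  by move=> /eqP[-> ->]; rewrite !big_cons !big_nil /= o2.
by case/orP=> /eqP[-> ->]; rewrite !big_cons !big_nil /= o2 mulg1 ?mulgV ?mulVg.
Qed.

(** The rules [RV] hold because $V$ is elementary abelian, [RM] by [iota_mul], and [RHbar] by the
    values given to the inverse letters. *)
Lemma Ry_holds (y : tuples p d h RH) l r :
  all (holds c h) (RHy y) -> (l, r) \in Ry rG y -> evalE c h l = evalE c h r.
Proof.
move=> hy; have vE j : evalE c h [:: inr j] = Defs.iota c (vbase p j).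
  by rewrite /evalE big_seq1.
rewrite /Ry mem_cat => /orP[/(allP hy)/eqP // | lr_in].
have /RyP : (l, r) \in Ry rG y by rewrite /Ry mem_cat lr_in orbT.
move lrE: (l, r) => lr sp.
case: sp lrE => [i | j | i j ij | j x | l' r' lr'] [-> ->].
- apply/eqP; apply: (allP hy (_, _)); apply/mapP.
  by exists i; rewrite ?mem_enum.
- have <- : Defs.iota c (\sum_(i < p) vbase p j) = evalE c h (nseq p (inr j)).
    by rewrite iota_prod /evalE big_nseq big_const_ord.
  rewrite sumr_const card_ord -scaler_nat pchar_Fp_0 // scale0r.
  by rewrite /Defs.iota add0r /evalE big_nil.
- rewrite -cat1s -[in RHS]cat1s !evalE_cat !vE -!Defs.iotaD addrC //.
- rewrite -cat1s -[in RHS]cat1s !evalE_cat vE evalE_bword iota_mul.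
  by rewrite (evalE_fst _ _ [:: x]) /evalH big_seq1.
- exact: evalE_bar.
Qed.

End Sound.

(** Every word reduces to some $u b^f$ with $u$ irreducible, and evaluation is invariant. The image
    of the value in $H$ determines $u$ by confluence of $R_H$; injectivity of [iota] then determines
    $f$. *)
Lemma xi_confluent (c : subvs_of (Z2 rG)) : confluent (Ry rG (xi h RH c)).
Proof.
set y := xi h RH c; have hy : all (holds c h) (RHy y).
  exact/(xiP _ _ evalH_rule).
have [decRH confRH] := RH_conf; have [_ wf _] := lta_red.
have norm w : exists u (f : 'rV['F_p]_d),
    irreducible_word RH u /\ rsteps (Ry rG y) w (abword d u ++ bword e f).
  have [u [f wuf]] := rsteps_split rG y p_prime w.
  suff [u' [f' [iu' uf]]] : exists u' (f' : 'rV['F_p]_d), irreducible_word RH u' /\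
      rsteps (Ry rG y) (abword d u ++ bword e f) (abword d u' ++ bword e f').
    by exists u', f'; split=> //; apply: rsteps_trans uf.
  (* The exponent [f] is generalized, since each reduction of [u] adds a correction to it. *)
  elim/(well_founded_ind wf): u {w wuf} f => u IH f.
  have [[v uv] | nred] := classic (exists v, rstep RH u v); last first.
    exists u, f; split; last exact: rt_refl.
    by move=> v uv; case: nred; exists v.
  have [g ug] := rsteps_lift_rstep rG y p_prime uv.
  have [u' [f' [iu' vf]]] := IH v (rstep_decr lta_red decRH uv) (g + f).
  exists u', f'; split=> //; apply: rsteps_trans vf.
  apply: rsteps_trans (rsteps_catr _ ug) _; rewrite -catA; apply: rsteps_catl.
  exact: rsteps_bwordD.
have inv w w' : rsteps (Ry rG y) w w' -> evalE c h w = evalE c h w'.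
  by move/rsteps_requiv; apply: requiv_prodg => l r; apply: Ry_holds.
move=> w w1 w2 /inv E1 /inv E2.
have [u1 [f1 [i1 s1]]] := norm w1; have [u2 [f2 [i2 s2]]] := norm w2.
have := E1; rewrite E2 (inv _ _ s1) (inv _ _ s2) !evalE_cat !evalE_bword => E.
have u12 : u1 = u2.
  apply: irreducible_unique confRH i1 i2 _; apply/RH_def.
  by have /(congr1 fst) := E; rewrite /= !mulg1 !evalE_fst.
move: E s1; rewrite u12 => /mulgI/iota_inj <- s1.
by exists (abword d u2 ++ bword e f2).
Qed.

(** * Recovering a cocycle from a confluent system *)

Section FromConfluent.
Variable y : tuples p d h RH.
Hypothesis y_conf : confluent (Ry rG y).
Local Notation D := (Ry rG y).

(** Passing to the normal form [v] of [u] shifts both exponents by the same [c]; both words are then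
    irreducible, hence equal by confluence. *)
Lemma bword_unique u (f f' : 'rV['F_p]_d) :
  requiv D (abword d u ++ bword e f) (abword d u ++ bword e f') -> f = f'.
Proof.
have [decRH _] := RH_conf.
have [v iv /rsteps_requiv/(requiv_lift rG y p_prime)[c uv] E] :=
  normal_form_exists u lta_red decRH.
have norm g : requiv D (abword d u ++ bword e g) (abword d v ++ bword e (c + g)).
  apply: requiv_trans (requiv_catr _ uv) _; rewrite -catA.
  exact/requiv_catl/rsteps_requiv/rsteps_bwordD.
have /eqP : abword d v ++ bword e (c + f) = abword d v ++ bword e (c + f').
  apply: (irreducible_unique y_conf); try exact: irreducible_normal_word.
  by apply: requiv_trans (rst_sym _ _ _ _ (norm f)) (requiv_trans E (norm f')).
by rewrite eqseq_cat // eqxx /= => /eqP/bword_inj/addrI.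
Qed.

Lemma requiv_evalH u v : evalH h u = evalH h v ->
  exists f : 'rV['F_p]_d, requiv D (abword d u) (abword d v ++ bword e f).
Proof. by move/RH_def/(requiv_lift rG y p_prime). Qed.

(* The section sends h_i to the letter a_i, so that the cocycle it determines
   makes a_i evaluate to u_i = (h_i, 1); this is where injectivity of h enters. *)
Lemma section_exists : exists s : gT -> seq (aletter e),
  forall g, evalH h (s g) = g /\ forall i, h i = g -> s g = [:: (i, true)].
Proof.
apply: (@fin_all_exists _ _ (fun g u => evalH h u = g /\
          forall i, h i = g -> u = [:: (i, true)])) => g.
have [i /eqP hi | nh] := pickP (fun i => h i == g).
  exists [:: (i, true)]; split; first by rewrite /evalH big_seq1.
  by move=> j; rewrite -hi => /h_inj ->.
have [u uE] := evalH_surj g; exists u; split=> // i hi.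
by have := nh i; rewrite hi eqxx.
Qed.

Lemma confluent_xi : exists c : subvs_of (Z2 rG), xi h RH c = y.
Proof.
have [s sP] := section_exists.
have sE g : evalH h (s g) = g by case: (sP g).
have [gm gmP] : exists gm : gT * gT -> 'rV['F_p]_d, forall gk,
    requiv D (abword d (s gk.1 ++ s gk.2))
             (abword d (s (gk.1 * gk.2)%g) ++ bword e (gm gk)).
  apply: (@fin_all_exists _ _ (fun gk f => requiv D (abword d (s gk.1 ++ s gk.2))
             (abword d (s (gk.1 * gk.2)%g) ++ bword e f))) => gk.
  by apply: requiv_evalH; rewrite evalH_cat !sE.
pose S g f : seq (letter e d) := abword d (s g) ++ bword e (f : 'rV['F_p]_d).
have SM g f k f' : requiv D (S g f ++ S k f')
    (S (g * k)%g (f *m rG k + f' + gm (g, k))).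
  apply: requiv_trans (rsteps_requiv (rsteps_mul rG y p_prime _ _ _ _)) _.
  rewrite sE; apply: requiv_trans (requiv_catr _ (gmP (g, k))) _.
  rewrite /S -catA [_ + gm _]addrC.
  exact/requiv_catl/rsteps_requiv/rsteps_bwordD.
(* The two bracketings of [S g 0 ++ S k 0 ++ S l 0] lead to exponents that [bword_unique]
   identifies, which is the cocycle identity. *)
have gmZ : [ffun gk => gm gk] \in Z2 rG.
  apply/mem_Z2=> g k l; rewrite !ffunE.
  have A := requiv_trans (requiv_catr (S l 0) (SM g 0 k 0)) (SM _ _ _ _).
  have B := requiv_trans (requiv_catl (S g 0) (SM k 0 l 0)) (SM _ _ _ _).
  rewrite -catA in A; have := requiv_trans (rst_sym _ _ _ _ A) B.
  rewrite -mulgA => /bword_unique.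
  by rewrite !mul0mx !add0r addr0.
pose c : subvs_of (Z2 rG) := Subvs gmZ; exists c.
(* Up to congruence, [T] inverts evaluation ([T_word]), and it is injective on each fibre over $H$
   ([T_inj]). *)
pose T (q : ext_of c) := S q.1 q.2.
have gamE g k : gam c g k = gm (g, k) by rewrite /gam /= ffunE.
have TM q q' : requiv D (T q ++ T q') (T (q * q')%g).
  by apply: requiv_trans (SM _ _ _ _) _; rewrite /T /= gamE; apply: rst_refl.
have T_inj q q' : q.1 = q'.1 -> requiv D (T q) (T q') -> q = q'.
  case: q q' => g f [g' f'] /= <- E; congr (_, _); exact: bword_unique E.
(* The empty word is congruent to [T (1, f)] for some [f]. Multiplicativity and injectivity of [T]
   make [(1, f)] idempotent, hence the identity. *)
have T1 : requiv D (T 1%g) [::].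
  have [|f f1] := @requiv_evalH [::] (s 1%g); first by rewrite sE /evalH big_nil.
  suff <- : (1%g, f) = 1%g :> ext_of c by apply: rst_sym.
  apply: (mulgI ((1%g, f) : ext_of c)); rewrite mulg1.
  apply: T_inj; first by rewrite /= mulg1.
  apply: requiv_trans (rst_sym _ _ _ _ (TM _ _)) _.
  have := requiv_catl (T (1%g, f)) (rst_sym _ _ _ _ f1); rewrite cats0.
  exact.
have Tiota v : requiv D (T (Defs.iota c v)) (bword e v).
  have -> : Defs.iota c v = (1%g, (1%g : ext_of c).2 + v) by rewrite addrC.
  apply: requiv_trans (rst_sym _ _ _ _ _) _; last first.
    exact: (requiv_catr (bword e v) T1).
  rewrite /T /S -catA; apply: rst_sym.
  apply/requiv_catl/rst_sym/rsteps_requiv; exact: rsteps_bwordD.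
have Ta i : T ((h i, 0) : ext_of c) = [:: inl (i, true)].
  by rewrite /T /S /= bword0 cats0; rewrite (proj2 (sP (h i)) i).
have T_letter x : requiv D [:: x] (T (eletter c h x)).
  case: x => [[i b]|j] /=; last first.
    apply: requiv_trans (rst_sym _ _ _ _ (Tiota _)).
    have := rsteps_sort rG y p_prime [:: j]; rewrite big_seq1.
    exact: rsteps_requiv.
  case: b => /=; first by rewrite Ta; apply: rst_refl.
  case: ifP => o2.
    rewrite Ta; apply/rsteps_requiv/rsteps_rule/RyP.
    apply: (@RyBar _ _ _ _ _ _ _ _ [:: (i, false)] [:: (i, true)]).
    by apply/flattenP; exists [:: ([:: (i, false)], [:: (i, true)])];
      rewrite ?inE //; apply/mapP; exists i; rewrite ?mem_enum ?o2.
  set u : ext_of c := (h i, 0).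
  (* Prefixing the trivial word [T (u^-1 * u)] gives [T (u^-1)] followed by $a_i a_i^{-1}$, which
     cancels. *)
  apply: requiv_trans (requiv_catr [:: inl (i, false)] (rst_sym _ _ _ _ T1)) _.
  rewrite -(mulVg u).
  apply: requiv_trans (requiv_catr _ (rst_sym _ _ _ _ (TM _ _))) _.
  rewrite Ta -catA -[X in requiv _ _ X]cats0; apply: requiv_catl.
  apply/rsteps_requiv/rsteps_rule/RyP.
  apply: (@RyBar _ _ _ _ _ _ _ _ [:: (i, true); (i, false)] [::]).
  apply/flattenP; exists [:: ([:: (i, true); (i, false)], [::]);
                        ([:: (i, false); (i, true)], [::])]; rewrite ?inE ?eqxx //.
  by apply/mapP; exists i; rewrite ?mem_enum ?o2.
have T_word w : requiv D w (T (evalE c h w)).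
  elim: w => [|x w IH]; first by rewrite /evalE big_nil; apply: rst_sym.
  rewrite -cat1s evalE_cat.
  apply: requiv_trans (requiv_cat _ IH) (TM _ _).
  by rewrite /evalE big_seq1; apply: T_letter.
symmetry; apply/(xiP _ _ evalH_rule)/allP => -[l r] lr_in; apply/eqP => /=.
apply: T_inj; last first.
  apply: requiv_trans (rst_sym _ _ _ _ (T_word l)) _.
  apply: requiv_trans (T_word r).
  by apply/rsteps_requiv/rsteps_rule; rewrite mem_cat lr_in.
case/mapP: lr_in => i _ [-> ->]; rewrite evalE_cat evalE_bword /= mulg1 !evalE_fst.
exact/evalH_rule/RHtilde_mem.
Qed.

End FromConfluent.

(** * Image and kernel of [xi], and the isomorphism with $H^2$ *)

Lemma mem_xiZ2 y : reflect (exists c : subvs_of (Z2 rG), xi h RH c = y) (y \in xiZ2 rG h RH).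
Proof.
apply: (iffP memv_imgP) => [[c _ ->] | [c <-]]; exists c; rewrite ?memvf ?lfunE //.
Qed.

(** If [xi] vanishes at [c], the rules of $R_H$ hold for the $u_i$ in the extension. Evaluation of
    [a]-words then factors through $H$ and yields a homomorphic section. *)
Lemma lker_xi_sub_B2 : (lker (xi_hom rG h RH) <= B2_in_Z2 rG)%VS.
Proof.
apply/subvP=> c; rewrite memv_ker lfunE /= => /eqP xi0.
have hy : all (holds c h) (RHy (0 : tuples p d h RH)).
  exact/(xiP _ _ evalH_rule).
have evR l r : (l, r) \in RH ->
    (\prod_(x <- l) eletter c h (inl x) = \prod_(x <- r) eletter c h (inl x))%g.
  move=> lrRH; have [lrbar | nlrbar] := boolP ((l, r) \in RHbar h).
    by have := evalE_bar c lrbar; rewrite /evalE !big_map.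
  have /tnthP[i lri] : (l, r) \in in_tuple (RHtilde h RH) by rewrite mem_filter nlrbar.
  have := allP hy _ (map_f _ (mem_enum _ i)) => /eqP /=.
  by rewrite -lri row0 bword0 cats0 /evalE !big_map.
have [s sP] : exists s : gT -> seq (aletter e), forall g, evalH h (s g) = g.
  exact: (@fin_all_exists _ _ (fun g u => evalH h u = g)) evalH_surj.
have evM g k : (evalE c h (abword d (s (g * k)%g)) =
    evalE c h (abword d (s g)) * evalE c h (abword d (s k)))%g.
  rewrite -evalE_cat -map_cat /evalE !big_map; apply: (requiv_prodg evR).
  by apply/RH_def; rewrite evalH_cat !sP.
rewrite -memv_preim lfunE /=; apply/memv_imgP.
(* With $t$ the $V$-coordinate of the section, [evM] reads $t(gk) = t(g)k + t(k) + c(g,k)$, so [c]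
   is the coboundary of $-t$. *)
exists [ffun g => - (evalE c h (abword d (s g))).2]; first exact: memvf.
apply/ffunP=> -[g k]; rewrite lfunE !ffunE /= evM /= !evalE_fst !sP.
by rewrite /gam mulNmx opprK -opprD addKr.
Qed.

Lemma H2_iso : exists f : {linear vquot (Z2 rG) (B2 rG) ->
                         vquot (xiZ2 rG h RH) (xiB2 rG h RH)},
        bijective f.
Proof.
have xi_in (c : subvs_of (Z2 rG)) : xi h RH c \in xiZ2 rG h RH by apply/mem_xiZ2; exists c.
pose F c := vclass (xiB2 rG h RH) (Subvs (xi_in c)).
have FE a b : reflect (vsval (a - b) \in B2 rG) (F a == F b).
  apply: (iffP eqP) => [/vclassP | ab].
    rewrite linearB /= -linearB /= => /memv_imgP[k kB]; rewrite lfunE /= => E.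
    (* Since [a - b] and [k] have the same image under [xi], they differ by an element of the
       kernel, hence of [B2]; as [k] lies in [B2], so does [a - b]. *)
    have: a - b - k \in lker (xi_hom rG h RH).
      by rewrite memv_ker lfunE /= linearB /= E subrr.
    move/(subvP lker_xi_sub_B2); move: kB; rewrite -!memv_preim !lfunE => kB abk.
    by have := memvD abk kB; rewrite -linearD subrK.
  apply/vclassP; rewrite linearB /= -linearB /=.
  by apply/memv_imgP; exists (a - b); rewrite ?lfunE // -memv_preim lfunE.
pose f (x : vquot (Z2 rG) (B2 rG)) := F (vrep x).
have fE c : f (vclass _ c) = F c.
  by apply/eqP/FE/vclassP; rewrite vrepK.
have f_lin : linear f.
  move=> a x x'; rewrite -[x]vrepK -[x']vrepK.
  have -> : a *: vclass (B2 rG) (vrep x) + vclass _ (vrep x') =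
            vclass _ (a *: vrep x + vrep x') by rewrite vclassD vclassZ.
  rewrite !fE.
  have -> : a *: F (vrep x) + F (vrep x') =
     vclass _ (a *: Subvs (xi_in (vrep x)) + Subvs (xi_in (vrep x'))).
    by rewrite vclassD vclassZ.
  congr vclass; apply/val_inj; exact: linearP.
pose flin := GRing.isSemilinear.Build 'F_p _ _ _ f (GRing.semilinear_linear f_lin).
pose fL : {linear vquot (Z2 rG) (B2 rG) -> vquot (xiZ2 rG h RH) (xiB2 rG h RH)} :=
  HB.pack f flin.
exists fL.
(* Surjectivity of [F]; a chosen preimage gives the inverse map, and [FE] makes its class
   independent of the choice. *)
have pre z : exists c, F c == z.
  have /mem_xiZ2[c cE] := subvsP (vrep z); exists c; apply/eqP.
  by rewrite -[z]vrepK; congr vclass; apply/val_inj.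
exists (fun z => vclass (B2 rG) (xchoose (pre z))) => [x | z] /=.
  rewrite -[RHS]vrepK; apply/vclassP/FE.
  by rewrite (eqP (xchooseP (pre (f x)))).
by rewrite fE; apply/eqP/(xchooseP (pre z)).
Qed.

End Cocycles.

Theorem theorem7p3 (gT : finGroupType) (e : nat) (h : 'I_e -> gT)
    (RH : seq (rule (aletter e)))
    (lta : seq (aletter e) -> seq (aletter e) -> Prop)
    (p d : nat) (rG : mx_representation 'F_p [set: gT] d)
    (h_inj : injective h)
    (h_gen : <<[set h i | i : 'I_e]>>%g = [set: gT])
    (lta_red : reduction_order lta)
    (RH_uniq : uniq RH)
    (RH_conf : confluent_rewriting_system lta RH)
    (RH_def : defines (evalH h) RH)
    (RH_inv : has_inverse_rules h RH)
    (p_prime : prime p) :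
  [/\ forall y : tuples p d h RH,
        confluent_rewriting_system (ablt lta) (Ry rG y) <->
        y \in xiZ2 rG h RH,
      (lker (xi_hom rG h RH) <= B2_in_Z2 rG)%VS
    & exists f : {linear vquot (Z2 rG) (B2 rG) ->
                         vquot (xiZ2 rG h RH) (xiB2 rG h RH)},
        bijective f].
Proof.
split=> [y||].
- split=> [[_ y_conf]|].
    by apply/mem_xiZ2/(confluent_xi h_inj h_gen lta_red RH_conf RH_def RH_inv p_prime).
  case/mem_xiZ2=> c <-; split; last exact: xi_confluent RH_conf RH_def p_prime _.
  exact: Ry_decreasing (RH_conf.1).
- exact: lker_xi_sub_B2.
- exact: H2_iso.
Qed.
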